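(* Let $p, q$ be real numbers with $1 < p \leq 2 \leq q$, let $1\le d\le n$ be integers, and let $h:\{-1,1\}^{n} \to \mathbb{C}$ be a $d$-homogeneous polynomial. Then $$\|h\|_{q} \leq \max\left\{(q-1)^{d/2}, \frac{1}{(p-1)^{d/2}} \right\}\|h\|_{p}.$$
   Context: A $d$-homogeneous polynomial on the discrete cube $\{-1,1\}^n$ (a Rademacher chaos of order $d$), with $n\ge d$, is a function of the form $h(x) = \sum_{1 \leq i_1<\ldots<i_d \leq n} a_{i_1,\ldots,i_d}\,x_{i_1}\cdots x_{i_d}$, $x=(x_1,\ldots,x_n)\in\{-1,1\}^n$, with complex coefficients $a_{i_1,\ldots,i_d}$. For $p>0$ and $f:\{-1,1\}^n\to\mathbb{C}$, $\|f\|_p = (\mathbb{E}|f|^p)^{1/p}$, where the expectation is with respect to the uniform probability measure on $\{-1,1\}^n$. *)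

(* Defs.v *)
From mathcomp Require Import all_boot all_order all_algebra.
From mathcomp Require Import complex.
From mathcomp Require Import reals exp.

Set Implicit Arguments.
Unset Strict Implicit.
Unset Printing Implicit Defensive.

Import Order.TTheory GRing.Theory Num.Theory.
Local Open Scope ring_scope.

(* A point of {-1,1}^n is encoded by its signs: the coordinate x_i is
   (-1) ^+ x i, so [false] stands for 1 and [true] for -1. *)
Definition cube (n : nat) : finType := {ffun 'I_n -> bool}.

Definition coord (R : realType) (n : nat) (x : cube n) (i : 'I_n) : R[i] :=
  (-1) ^+ x i.

Definition homogeneous_poly (R : realType) (n d : nat)
    (a : d.-tuple 'I_n -> R[i]) (x : cube n) : R[i] :=
  \sum_(t : d.-tuple 'I_n | sorted (fun i j : 'I_n => (i < j)%N) t)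
    a t * \prod_(k < d) coord R x (tnth t k).

Definition is_homogeneous (R : realType) (n d : nat) (h : cube n -> R[i]) : Prop :=
  exists a : d.-tuple 'I_n -> R[i], forall x, h x = homogeneous_poly a x.

Definition expectation (R : realType) (n : nat) (g : cube n -> R) : R :=
  (\sum_(x : cube n) g x) / #|cube n|%:R.

(* [normc z] is the modulus of z as an element of R, whereas `|z| lies in R[i]. *)
Definition pnorm (R : realType) (n : nat) (p : R) (f : cube n -> R[i]) : R :=
  powR (expectation (fun x => powR (ComplexField.Normc.normc (f x)) p)) p^-1.

(* Main.v *)
Require Import Defs.
From mathcomp Require Import all_boot all_order all_algebra.
From mathcomp Require Import complex.
From mathcomp Require Import reals exp.
From mathcomp Require Import boolp classical_sets interval_inference topology.
From mathcomp Require Import normedtype derive realfun convex hoelder.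
From mathcomp Require Import ring lra.

Import Order.TTheory GRing.Theory Num.Theory.
Local Open Scope ring_scope.
Import numFieldNormedType.Exports.
Import ComplexField.Normc.

(* The noise operator with the imaginary parameter z = i r multiplies a
   d-homogeneous h by (i r)^d, so it suffices that it be a contraction from L^p
   to L^q when r^2 = min (p - 1, 1 / (q - 1)); being imaginary, z avoids the
   loss of the real parameter, whose square is only (p - 1) / (q - 1).
   Contractivity tensorizes by Minkowski's inequality in L^(q/p), leaving the
   two-point space and f(e) = a + e b, with a real after a rotation.
   Writing b = x + i y and averaging over signs e, Beckner's argument compares
   both sides with the same quantity:
     ||(a - e r y)^2 + r^2 x^2||_(q/2) <= a^2 + (q-1) r^2 y^2 + r^2 x^2
                                       <= a^2 + y^2 + r^2 x^2
                                       <= a^2 + (p-1) x^2 + y^2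
                                       <= ||(a + e x)^2 + y^2||_(p/2),
   where the outer steps combine (reverse) Minkowski with the real two-point
   inequalities L^2 -> L^q and L^p -> L^2. *)

(** * Real two-point inequalities *)

Section TwoPoint.
Variable R : realType.
Implicit Types (a b c k l x y p q r s t : R).

Lemma ler_powRl s x y : 0 <= s -> 0 <= x -> x <= y -> x `^ s <= y `^ s.
Proof.
by move=> s0 x0 xy; apply: ge0_ler_powR; rewrite ?nnegrE// (le_trans x0).
Qed.

Lemma le_of_is_derive_ge0 (f df : R -> R) a b : a <= b ->
  (forall x, a <= x <= b -> is_derive x 1 f (df x)) ->
  (forall x, a <= x <= b -> 0 <= df x) -> f a <= f b.
Proof.
move=> ab fdf df0.
have [||c cab fab] := @MVT_segment R f df a b ab.
- by move=> x; rewrite in_itv/= => /andP[ax xb]; apply: fdf; rewrite !ltW.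
- apply: derivable_within_continuous => x; rewrite in_itv/= => xab.
  exact: (@ex_derive _ _ _ _ _ _ _ (fdf x xab)).
by rewrite -subr_ge0 fab mulr_ge0 ?subr_ge0// df0.
Qed.

Lemma is_derive_scale c x : is_derive x 1 (fun y => c * y) c.
Proof.
rewrite -[X in is_derive _ _ _ X](_ : c *: 1 = c); last exact: mulr1.
exact: (@is_deriveZ _ _ _ id c x 1 1).
Qed.

Lemma is_derive_powR_affine b c s x : 0 < b + c * x ->
  is_derive x 1 (fun y => (b + c * y) `^ s) (s * c * (b + c * x) `^ (s - 1)).
Proof.
move=> h.
have dg : is_derive x 1 (fun y => b + c * y) c.
  rewrite -[X in is_derive _ _ _ X]add0r.
  by apply: is_deriveD; exact: is_derive_scale.
have := is_derive1_powR s h => df.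
have := @is_derive1_comp R (fun y => y `^ s) (fun y => b + c * y) x _ _ df dg.
by move=> /is_derive_eq; apply; rewrite mulrAC.
Qed.

Lemma powR_bernoulli s x : 0 <= s <= 1 -> 0 <= x -> (1 + x) `^ s <= 1 + s * x.
Proof.
move=> /andP[s0 s1] x0.
pose f y := 1 + s * y - (1 + 1 * y) `^ s.
pose df y := s - s * 1 * (1 + 1 * y) `^ (s - 1).
suff : f 0 <= f x by rewrite /f !mulr0 addr0 powR1 subrr mul1r subr_ge0.
apply: (@le_of_is_derive_ge0 f df) => // y /andP[y0 yx].
- have := @is_derive_powR_affine 1 1 s y; rewrite /df => dp.
  have {}dp := dp (ltac:(lra)).
  rewrite /df -[X in X - _]add0r; apply: is_deriveB; apply: is_deriveD; exact: is_derive_scale.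
- rewrite /df mulr1 -{1}[s]mulr1 -mulrBr mulr_ge0// subr_ge0.
  rewrite -[leRHS](powRr0 (1 + 1 * y)); apply: ler_powR; lra.
Qed.

(** Second-order comparison at 0: the difference of the two sides vanishes there together with its
    derivative, which is a multiple of [h], and [h] increases by the arithmetic-geometric mean
    inequality. Taking y < 1 keeps the base 1 - y positive, where the power is differentiable. *)
Lemma two_point_lower_unit_lt p y : 1 < p <= 2 -> 0 <= y < 1 ->
  1 + p * (p - 1) / 2 * y ^+ 2 <= ((1 + y) `^ p + (1 - y) `^ p) / 2.
Proof.
move=> /andP[p1 p2] /andP[y0 y1].
pose h z := (1 + 1 * z) `^ (p - 1) - (1 + -1 * z) `^ (p - 1) - 2 * (p - 1) * z.
pose dh z := (p - 1) * 1 * (1 + 1 * z) `^ (p - 1 - 1)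
  - (p - 1) * -1 * (1 + -1 * z) `^ (p - 1 - 1) - 2 * (p - 1).
have h0 z : 0 <= z < 1 -> 0 <= h z.
  move=> /andP[z0 z1].
  suff : h 0 <= h z by rewrite {1}/h !mulr0 addr0 powR1 subrr subr0.
  apply: (@le_of_is_derive_ge0 h dh) => // x /andP[x0 xz].
    rewrite /dh.
    apply: is_deriveB; last exact: is_derive_scale.
    by apply: is_deriveB; apply: is_derive_powR_affine; lra.
  set u := (1 + 1 * x) `^ (p - 1 - 1); set v := (1 + -1 * x) `^ (p - 1 - 1).
  have u0 : 0 < u by apply: powR_gt0; lra.
  have v0 : 0 < v by apply: powR_gt0; lra.
  (* Here u v = (1 - x^2)^(p - 2), with base at most 1 and exponent at most 0; then u + v >= 2, so
     [dh] is nonnegative. *)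
  suff uv : 1 <= u * v.
    rewrite /dh -/u -/v; have uv2 : 2 <= u + v.
      have := sqr_ge0 (u - v) => ?; rewrite -ler_sqr ?nnegrE; nra.
    nra.
  rewrite /u /v -powRM; [|lra|lra].
  rewrite -[leLHS](powRr0 ((1 + 1 * x) * (1 + -1 * x))).
  by apply: ger_powR; [nra|lra].
pose f z := (1 + 1 * z) `^ p + (1 + -1 * z) `^ p - p * (p - 1) * z ^+ 2.
pose df z := p * 1 * (1 + 1 * z) `^ (p - 1) + p * -1 * (1 + -1 * z) `^ (p - 1)
   - p * (p - 1) * (2 * z).
suff : f 0 <= f y.
  rewrite {1}/f /f !mulr0 addr0 powR1 expr0n/= mulr0 subr0 mulN1r mul1r; lra.
apply: (@le_of_is_derive_ge0 f df) => // z /andP[z0 zy].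
  rewrite /df; apply: is_deriveB; first apply: is_deriveD;
    try (apply: is_derive_powR_affine; lra).
  have dz : is_derive z 1 (fun y : R => y ^+ 2) (2 * z).
    rewrite (_ : 2 * z = z *: 1 + z *: 1); last by rewrite /GRing.scale/= mulr1 mulr_natl.
    by apply: (@is_deriveM _ _ id id z 1 1 1).
  exact: (@is_deriveZ _ _ _ (fun y => y ^+ 2) _ z 1 (2 * z)).
have := h0 z; rewrite z0 (le_lt_trans zy)// => /(_ isT); rewrite /df /h.
set u := _ `^ _; set v := _ `^ _ => uv.
suff : 0 <= p * (u - v - 2 * (p - 1) * z) by lra.
by rewrite mulr_ge0//; lra.
Qed.

Lemma two_point_lower_unit p y : 1 < p <= 2 -> 0 <= y <= 1 ->
  1 + p * (p - 1) / 2 * y ^+ 2 <= ((1 + y) `^ p + (1 - y) `^ p) / 2.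
Proof.
move=> pp /andP[y0]; have /andP[p1 p2] := pp.
rewrite le_eqVlt => /predU1P[->|y1]; last by apply: two_point_lower_unit_lt; lra.
rewrite expr1n mulr1 subrr powR0 ?addr0; last by lra.
set c := p * (p - 1) / 2; set L := (1 + 1) `^ p.
have c1 : c <= 1 by rewrite /c; nra.
have c0 : 0 <= c by rewrite /c; nra.
(* The endpoint y = 1 is a limit of the previous lemma, made explicit: at 1 - e the loss is at most
   5e/2 in total (2e from the square, e/2 from e^p <= e), and e is at most a quarter of the supposed
   gap. *)
rewrite leNgt; apply/negP => gap.
pose e := Num.min (1/2) ((1 + c - L / 2) / 4).
have e0 : 0 < e by rewrite /e lt_min; lra.
have e12 : e <= 1/2 by rewrite /e ge_min lexx.
have e2 : e <= (1 + c - L / 2) / 4 by rewrite /e ge_min lexx orbT.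
have := @two_point_lower_unit_lt p (1 - e) pp.
have -> : 1 - (1 - e) = e by lra.
have : (1 + (1 - e)) `^ p <= L by apply: ler_powRl; lra.
have : e `^ p <= e by apply: ge1r_powR; lra.
rewrite -/c => h1 h2 /(_ ltac:(lra)) h3.
have : c * (1 - e) ^+ 2 >= c - 2 * e by nra.
lra.
Qed.

(** The real inequality from L^p to L^2 with p = 2s, squares replacing absolute values. After
    reducing to 0 <= b <= a and dividing by a, Bernoulli with exponent s = p/2 linearizes the
    left-hand side into the quadratic bound of [two_point_lower_unit]. *)
Lemma two_point_lower s a b : 1 < 2 * s -> s <= 1 ->
  (a ^+ 2 + (2 * s - 1) * b ^+ 2) `^ s <=
  (((a + b) ^+ 2) `^ s + ((a - b) ^+ 2) `^ s) / 2.
Proof.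
move=> s1 s2.
have sq c : 0 <= c -> (c ^+ 2) `^ s = c `^ (2 * s).
  by move=> c0; rewrite powRrM powR_mulrn.
have sqN c : (- c) ^+ 2 = c ^+ 2 by rewrite sqrrN.
have main x : 0 <= x <= 1 -> (1 + (2 * s - 1) * x ^+ 2) `^ s <=
  (((1 + x) ^+ 2) `^ s + ((1 - x) ^+ 2) `^ s) / 2.
  move=> /andP[x0 x1]; rewrite !sq; try lra.
  apply: le_trans (@two_point_lower_unit (2 * s) x _ _); try lra.
  apply: le_trans (@powR_bernoulli _ _ _ _) _; try lra; nra.
have pos c d : 0 <= d <= c -> (c ^+ 2 + (2 * s - 1) * d ^+ 2) `^ s <=
  (((c + d) ^+ 2) `^ s + ((c - d) ^+ 2) `^ s) / 2.
  move=> /andP[d0 dc]; have [c0|c0] := leP c 0.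
    have -> : d = 0 by lra.
    rewrite expr0n/= mulr0 !addr0 subr0; lra.
  have -> : d = c * (d / c) by rewrite mulrC divfK// gt_eqF.
  set x := d / c; have x01 : 0 <= x <= 1.
    by rewrite divr_ge0 ?(ltW c0)//= ler_pdivrMr ?mul1r.
  have -> : c ^+ 2 + (2 * s - 1) * (c * x) ^+ 2 = c ^+ 2 * (1 + (2 * s - 1) * x ^+ 2).
    by ring.
  have -> : (c + c * x) ^+ 2 = c ^+ 2 * (1 + x) ^+ 2 by ring.
  have -> : (c - c * x) ^+ 2 = c ^+ 2 * (1 - x) ^+ 2 by ring.
  have xx := sqr_ge0 x.
  rewrite !(@powRM _ (c ^+ 2)) ?sqr_ge0//; last by nra.
  by rewrite -mulrDr -mulrA ler_wpM2l ?powR_ge0// main.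
wlog a0 : a / 0 <= a => [H|].
  have [/H//|an] := leP 0 a; have := H (- a) ltac:(lra).
  rewrite sqN (_ : (- a + b) ^+ 2 = (a - b) ^+ 2); last by ring.
  rewrite (_ : (- a - b) ^+ 2 = (a + b) ^+ 2); last by ring.
  by rewrite (addrC (((a - b) ^+ 2) `^ s)).
wlog b0 : b / 0 <= b => [H|].
  have [/H//|bn] := leP 0 b; have := H (- b) ltac:(lra).
  by rewrite sqN opprK (addrC (((a - b) ^+ 2) `^ s)).
(* For b > a exchanging the roles of a and b only increases the left-hand side. *)
have [ba|ab] := leP b a; first by apply: pos; rewrite b0.
have := @pos b a; rewrite a0 (ltW ab) => /(_ isT).
rewrite [b + a]addrC -[(b - a) ^+ 2]sqN opprB; apply: le_trans.
have ab2 : a ^+ 2 <= b ^+ 2 by rewrite ler_sqr ?nnegrE// ltW.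
apply: ler_powRl; first lra.
  by rewrite addr_ge0 ?mulr_ge0 ?sqr_ge0//; lra.
rewrite -subr_ge0 (_ : _ - _ = (2 - 2 * s) * (b ^+ 2 - a ^+ 2)); last by ring.
by rewrite mulr_ge0//; lra.
Qed.

Lemma addr_sqr_ge0 c x y : 0 <= c -> 0 <= x ^+ 2 + c * y ^+ 2.
Proof.
by move=> c0; rewrite addr_ge0 ?sqr_ge0//; apply: mulr_ge0; rewrite ?sqr_ge0.
Qed.

(* Dual to two_point_lower at s' = s / (2s - 1), for which 2s' - 1 = 1 / (2s - 1):
   test (a + b, a - b) against g, the extremal function of Hoelder's
   inequality, and apply Cauchy-Schwarz. *)
Lemma two_point_upper s a b : 1 <= s ->
  (((a + b) ^+ 2) `^ s + ((a - b) ^+ 2) `^ s) / 2 <=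
  (a ^+ 2 + (2 * s - 1) * b ^+ 2) `^ s.
Proof.
move=> s1; pose s' := s / (2 * s - 1).
have s0 : s != 0 by rewrite gt_eqF//; lra.
have d0 : 2 * s - 1 != 0 by rewrite gt_eqF//; lra.
(* That is, sign(c) |c|^(2s - 1). Since 2s' is the exponent conjugate to 2s, |g c|^(2s') =
   |c|^(2s). *)
pose g c := c * (c ^+ 2) `^ (s - 1).
have cg c : c * g c = (c ^+ 2) `^ s.
  by rewrite /g mulrA -expr2 mulr_powRB1 ?sqr_ge0//; lra.
have gs c : (g c ^+ 2) `^ s' = (c ^+ 2) `^ s.
  have [->|c0] := eqVneq c 0.
    rewrite /g mul0r expr0n/= !powR0// /s' mulf_neq0// invr_neq0//.
  have c2 : c ^+ 2 != 0 by rewrite expf_neq0.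
  rewrite /g exprMn -[X in c ^+ 2 * X]powR_mulrn ?powR_ge0// -powRrM.
  rewrite -{1}(powRr1 (sqr_ge0 c)) -powRD ?c2 ?implybT// -powRrM /s'.
  by congr (_ `^ _); field.
set S := _ / 2; set K := _ + _.
pose A := (g (a + b) + g (a - b)) / 2; pose B := (g (a + b) - g (a - b)) / 2.
have SE : S = a * A + b * B by rewrite /S -!cg /A /B; field.
have K0 : 0 <= K by apply: addr_sqr_ge0; lra.
have S0 : 0 <= S by rewrite /S divr_ge0 ?addr_ge0 ?powR_ge0.
(* Cauchy-Schwarz with weights 2s - 1 and its inverse on the second coordinate; the defect is an
   explicit square. *)
have CS : S ^+ 2 <= K * (A ^+ 2 + (2 * s - 1)^-1 * B ^+ 2).
  rewrite SE -subr_ge0 (_ : _ - _ = (2 * s - 1)^-1 * ((2 * s - 1) * b * A - a * B) ^+ 2).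
    by apply: mulr_ge0; rewrite ?sqr_ge0// invr_ge0; lra.
  by rewrite /K; field.
have s'E : 2 * s' - 1 = (2 * s - 1)^-1 by rewrite /s'; field.
have s'0 : 0 < s' by rewrite /s' divr_gt0//; lra.
have := @two_point_lower s' A B; rewrite s'E.
have -> : A + B = g (a + b) by rewrite /A /B; field.
have -> : A - B = g (a - b) by rewrite /A /B; field.
rewrite !gs -/S; set M := A ^+ 2 + _ in CS *.
have M0 : 0 <= M by apply: addr_sqr_ge0; rewrite invr_ge0; lra.
have i0 : 0 < (2 * s - 1)^-1 by rewrite invr_gt0; lra.
have s'1 : s' <= 1 by rewrite /s' ler_pdivrMr; lra.
move=> /(_ ltac:(lra) s'1) MS.
have {}MS : M <= S `^ s'^-1.
  have := @ler_powRl s'^-1 _ _ _ _ MS.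
  rewrite invr_ge0 (ltW s'0) powR_ge0 -powRrM mulfV ?powRr1// ?gt_eqF//.
  exact.
have [S00|Sn0] := eqVneq S 0; first by rewrite S00 powR_ge0.
have Sp : 0 < S by rewrite lt_def Sn0.
have s'V : s'^-1 = 2 - s^-1 by rewrite /s'; field; rewrite s0.
(* Now S^2 <= K M <= K S^(1/s'), and 1/s' = 2 - 1/s, so cancelling S^(1/s') leaves S^(1/s). *)
have : S `^ s^-1 <= K.
  rewrite -(@ler_pM2r _ (S `^ s'^-1)) ?powR_gt0// -powRD ?Sn0 ?implybT//.
  rewrite s'V addrC subrK -s'V powR_mulrn//.
  by apply: le_trans CS _; rewrite ler_wpM2l.
move=> /(@ler_powRl s _ _ _ _).
rewrite powR_ge0 -powRrM mulVf// powRr1//; apply => //; lra.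
Qed.

(** * Minkowski-type inequalities with a constant summand *)

Lemma powR_convex t l x y : 1 <= t -> 0 <= l <= 1 -> 0 <= x -> 0 <= y ->
  (l * x + (1 - l) * y) `^ t <= l * x `^ t + (1 - l) * y `^ t.
Proof.
move=> t1 /andP[l0 l1] x0 y0.
have xI : x \in `[0, +oo[%classic by rewrite inE/= in_itv/= x0.
have yI : y \in `[0, +oo[%classic by rewrite inE/= in_itv/= y0.
have l01 : 0 <= l <= 1 by rewrite l0.
have := @convex_powR R t t1 (Itv01 l0 l1) x y xI yI.
by rewrite !convRE.
Qed.

(* Minkowski's inequality in L^t with one constant summand y. *)
Lemma powR_mean_shift_ge1 t x1 x2 k y : 1 <= t ->
  0 <= x1 -> 0 <= x2 -> 0 <= k -> 0 <= y ->
  (x1 `^ t + x2 `^ t) / 2 <= k `^ t ->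
  ((x1 + y) `^ t + (x2 + y) `^ t) / 2 <= (k + y) `^ t.
Proof.
move=> t1 x10 x20; have t0 : t != 0 by rewrite gt_eqF//; lra.
rewrite le_eqVlt => /predU1P[<- y0|k0 y0 xk].
  rewrite powR0// => h.
  have := powR_ge0 x1 t; have := powR_ge0 x2 t => h1 h2.
  have -> : x1 = 0 by apply: (@powR_eq0_eq0 _ _ t); lra.
  have -> : x2 = 0 by apply: (@powR_eq0_eq0 _ _ t); lra.
  rewrite add0r; lra.
have ky : 0 < k + y by lra.
(* (x + y)/(k + y) is the convex combination of x/k and 1 with weight l. Convexity bounds its t-th
   power through x^t/k^t, whose mean over x1 and x2 is at most 1. *)
pose l := k / (k + y).
have l01 : 0 <= l <= 1.
  by rewrite /l divr_ge0 ?(ltW k0) ?(ltW ky)//= ler_pdivrMr// mul1r; lra.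
have E x : 0 <= x ->
    (x + y) `^ t <= (k + y) `^ t * (l * (x `^ t / k `^ t) + (1 - l)).
  move=> x0; rewrite (_ : x + y = (k + y) * (l * (x / k) + (1 - l) * 1)); last first.
    by rewrite /l; field; rewrite !gt_eqF.
  have xk0 : 0 <= x / k by rewrite divr_ge0// ltW.
  have /andP[l0 l1] := l01.
  rewrite powRM ?(ltW ky)//; last by apply: addr_ge0; apply: mulr_ge0; lra.
  rewrite ler_wpM2l ?powR_ge0//.
  apply: le_trans (@powR_convex _ _ _ _ t1 l01 xk0 ler01) _.
  rewrite powR1 mulr1 powRM ?invr_ge0 ?(ltW k0)// -powR_inv1 ?(ltW k0)//.
  by rewrite powRAC powR_inv1 ?powR_ge0.
have := lerD (E _ x10) (E _ x20).
rewrite -mulrDr => h; rewrite ler_pdivrMr//; apply: le_trans h _.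
rewrite ler_wpM2l ?powR_ge0// addrACA -mulrDr -mulrDl.
have kt : 0 < k `^ t by exact: powR_gt0.
have : (x1 `^ t + x2 `^ t) / k `^ t <= 2 by rewrite ler_pdivrMr//; lra.
have /andP[l0 l1] := l01; move: (_ / k `^ t) => z hz.
have := ler_wpM2l l0 hz; lra.
Qed.

(* Reverse Minkowski's inequality in L^s with one constant summand y. *)
Lemma powR_mean_shift_le1 s x1 x2 k y : 0 < s <= 1 ->
  0 <= x1 -> 0 <= x2 -> 0 <= k -> 0 <= y ->
  k `^ s <= (x1 `^ s + x2 `^ s) / 2 ->
  (k + y) `^ s <= ((x1 + y) `^ s + (x2 + y) `^ s) / 2.
Proof.
move=> /andP[s0 s1] x10 x20.
rewrite le_eqVlt => /predU1P[<- y0 _|k0 y0 xk].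
  have h x : 0 <= x -> (0 + y) `^ s <= (x + y) `^ s by move=> ?; apply: ler_powRl; lra.
  have := h _ x10; have := h _ x20; lra.
have ky : 0 < k + y by lra.
pose l := k / (k + y).
have l01 : 0 <= l <= 1.
  by rewrite /l divr_ge0 ?(ltW k0) ?(ltW ky)//= ler_pdivrMr// mul1r; lra.
have /andP[l0 l1] := l01.
have t1 : 1 <= s^-1 by rewrite invf_ge1.
have E x : 0 <= x ->
    (k + y) `^ s * (l * (x `^ s / k `^ s) + (1 - l)) <= (x + y) `^ s.
  move=> x0; rewrite (_ : x + y = (k + y) * (l * (x / k) + (1 - l) * 1)); last first.
    by rewrite /l; field; rewrite !gt_eqF.
  have xk0 : 0 <= x / k by rewrite divr_ge0// ltW.
  rewrite powRM ?(ltW ky)//; last by apply: addr_ge0; apply: mulr_ge0; lra.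
  rewrite ler_wpM2l ?powR_ge0//.
  rewrite -powR_inv1 ?powR_ge0// powRAC -powRM ?powR_ge0// powR_inv1 ?(ltW k0)//.
  (* Concavity of the s-th power, obtained from convexity of the power 1/s at the points (x/k)^s and
     1. *)
  have := @powR_convex s^-1 l ((x / k) `^ s) 1 t1 l01 (powR_ge0 _ _) ler01.
  rewrite powR1 -powRrM mulfV ?gt_eqF// powRr1// => /(@ler_powRl s _ _ (ltW s0) (powR_ge0 _ _)).
  rewrite -powRrM mulVf ?gt_eqF// powRr1; last first.
    by apply: addr_ge0; apply: mulr_ge0; rewrite ?powR_ge0//; lra.
  by rewrite mulr1.
have := lerD (E _ x10) (E _ x20).
rewrite -mulrDr => h; rewrite ler_pdivlMr//; apply: le_trans h.
rewrite ler_wpM2l ?powR_ge0// addrACA -mulrDr -mulrDl.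
have kt : 0 < k `^ s by exact: powR_gt0.
have : 2 <= (x1 `^ s + x2 `^ s) / k `^ s by rewrite ler_pdivlMr//; lra.
move: (_ / k `^ s) => z hz.
have := ler_wpM2l l0 hz; lra.
Qed.

(** * The complex two-point inequality and Minkowski's inequality for finite sums *)

Lemma normc_powR (z : R[i]) p :
  normc z `^ p = (complex.Re z ^+ 2 + complex.Im z ^+ 2) `^ (p / 2).
Proof.
case: z => a b /=; rewrite -powR12_sqrt ?addr_ge0 ?sqr_ge0// -powRrM.
by congr (_ `^ _); rewrite mulrC.
Qed.

Lemma two_point_complex_real p q r a (B : R[i]) : 1 < p <= 2 -> 2 <= q ->
  r ^+ 2 <= p - 1 -> r ^+ 2 * (q - 1) <= 1 ->
  ((normc (a%:C%C + (0 +i* r)%C * B) `^ q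
    + normc (a%:C%C - (0 +i* r)%C * B) `^ q) / 2) `^ q^-1 <=
  ((normc (a%:C%C + B) `^ p + normc (a%:C%C - B) `^ p) / 2) `^ p^-1.
Proof.
move=> /andP[p1 p2] q2 rp rq; case: B => x y.
rewrite !normc_powR /=.
rewrite !mul0r ?sub0r ?addr0 ?add0r ?opprK ?oppr0 ?addr0 ?add0r ?sub0r.
rewrite !sqrrN.
have x2 := sqr_ge0 x; have y2 := sqr_ge0 y; have r2 := sqr_ge0 r.
(* The middle term of Beckner's chain; both sides are compared with its square root. *)
pose K := a ^+ 2 + y ^+ 2 + r ^+ 2 * x ^+ 2.
have a2 := sqr_ge0 a; have rx2 : 0 <= r ^+ 2 * x ^+ 2 by apply: mulr_ge0.
have K0 : 0 <= K by rewrite /K; lra.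
apply: (@le_trans _ _ (K `^ 2^-1)).
  rewrite [in leRHS](_ : 2^-1 = q / 2 * q^-1); last by field; rewrite gt_eqF//; lra.
  rewrite [K `^ _]powRrM; apply: ler_powRl.
  - by rewrite invr_ge0; lra.
  - by rewrite divr_ge0 ?addr_ge0 ?powR_ge0.
  (* The numbers a + i r B and a - i r B have real parts a - r y and a + r y, and the same squared
     imaginary part r^2 x^2, which is the constant summand. *)
  apply: (@le_trans _ _ ((a ^+ 2 + (2 * (q / 2) - 1) * (r * y) ^+ 2
                          + r ^+ 2 * x ^+ 2) `^ (q / 2))).
    rewrite -!exprMn; apply: powR_mean_shift_ge1; rewrite ?sqr_ge0//; first lra.
      by apply: addr_sqr_ge0; lra.
    rewrite addrC.
    by apply: two_point_upper; lra.
  have rqy : 0 <= (1 - r ^+ 2 * (q - 1)) * y ^+ 2 by apply: mulr_ge0; lra.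
  apply: ler_powRl; [lra| |].
    apply: addr_ge0 => //; apply: addr_sqr_ge0; lra.
  by rewrite /K -subr_ge0 (_ : _ - _ = (1 - r ^+ 2 * (q - 1)) * y ^+ 2)//; field.
rewrite [in leLHS](_ : 2^-1 = p / 2 * p^-1); last by field; rewrite gt_eqF//; lra.
rewrite [K `^ _]powRrM; apply: ler_powRl; rewrite ?powR_ge0//.
  by rewrite invr_ge0; lra.
apply: (@le_trans _ _ ((a ^+ 2 + (2 * (p / 2) - 1) * x ^+ 2 + y ^+ 2) `^ (p / 2))).
  have rpx : 0 <= (p - 1 - r ^+ 2) * x ^+ 2 by apply: mulr_ge0; lra.
  apply: ler_powRl => //; first lra.
  by rewrite /K -subr_ge0 (_ : _ - _ = (p - 1 - r ^+ 2) * x ^+ 2)//; field.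
apply: powR_mean_shift_le1; rewrite ?sqr_ge0//; first lra.
  by apply: addr_sqr_ge0; lra.
by apply: two_point_lower; lra.
Qed.

Lemma normc_real_complex a : 0 <= a -> normc (a%:C%C) = a.
Proof. by move=> a0 /=; rewrite expr0n/= addr0 sqrtr_sqr ger0_norm. Qed.

Lemma two_point_complex p q r (A B : R[i]) : 1 < p <= 2 -> 2 <= q ->
  r ^+ 2 <= p - 1 -> r ^+ 2 * (q - 1) <= 1 ->
  ((normc (A + (0 +i* r)%C * B) `^ q
    + normc (A - (0 +i* r)%C * B) `^ q) / 2) `^ q^-1 <=
  ((normc (A + B) `^ p + normc (A - B) `^ p) / 2) `^ p^-1.
Proof.
move=> p12 q2 rp rq; have [->|A0] := eqVneq A 0.
  by have := @two_point_complex_real p q r 0 B p12 q2 rp rq.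
have nA0 : normc A != 0 by apply: contra A0 => /eqP/eq0_normc ->.
have nA : 0 <= normc A by case: (A) => a b; rewrite sqrtr_ge0.
(* A unimodular factor rotating A onto the nonnegative real axis; it changes none of the four
   moduli. *)
pose u := (normc A)%:C%C / A.
have nu z : normc (u * z) = normc z.
  by rewrite !normcM normcV normc_real_complex// divff// mul1r.
have uA : u * A = (normc A)%:C%C by rewrite divfK.
have := @two_point_complex_real p q r (normc A) (u * B) p12 q2 rp rq.
by rewrite -uA mulrCA -!mulrDr -!mulrBr !nu.
Qed.

(** With U and V the two norms on the right, (u + v)/(U + V) is pointwise the convex combination of
    u/U and v/V with weight U/(U + V). Convexity of the s-th power is then summed against w, where
    both normalized sums equal 1. *)
Lemma weighted_minkowski (I : finType) (w u v : I -> R) s : 1 <= s ->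
  (forall i, 0 <= w i) -> (forall i, 0 <= u i) -> (forall i, 0 <= v i) ->
  (\sum_i w i * (u i + v i) `^ s) `^ s^-1 <=
  (\sum_i w i * u i `^ s) `^ s^-1 + (\sum_i w i * v i `^ s) `^ s^-1.
Proof.
move=> s1 w0 u0 v0; have s0 : 0 < s by lra.
have sn0 : s != 0 by rewrite gt_eqF.
have T0 (f : I -> R) : 0 <= \sum_i w i * f i `^ s.
  by apply: sumr_ge0 => i _; apply: mulr_ge0; rewrite ?powR_ge0.
(* If a norm vanishes, each index has zero weight or a zero value, so that function drops out of the
   sum. *)
have zero (f g : I -> R) : (\sum_i w i * f i `^ s) `^ s^-1 = 0 ->
    \sum_i w i * (f i + g i) `^ s = \sum_i w i * g i `^ s.
  move=> /powR_eq0_eq0/eqP.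
  rewrite psumr_eq0; last by move=> i _; apply: mulr_ge0; rewrite ?powR_ge0.
  move=> /allP fi; apply: eq_bigr => i _.
  have := fi i (mem_index_enum i); rewrite /= mulf_eq0 => /orP[/eqP ->|].
    by rewrite !mul0r.
  by move=> /eqP/powR_eq0_eq0 ->; rewrite add0r.
set U := (\sum_i w i * u i `^ s) `^ s^-1; set V := (\sum_i w i * v i `^ s) `^ s^-1.
have [U0|Un0] := eqVneq U 0; first by rewrite (zero _ _ U0) U0 add0r.
have [V0|Vn0] := eqVneq V 0.
  rewrite V0 addr0; under eq_bigr do rewrite addrC.
  by rewrite (zero _ _ V0).
have Up : 0 < U by rewrite lt_def Un0 powR_ge0.
have Vp : 0 < V by rewrite lt_def Vn0 powR_ge0.
have Us : \sum_i w i * u i `^ s = U `^ s by rewrite -powRrM mulVf// powRr1.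
have Vs : \sum_i w i * v i `^ s = V `^ s by rewrite -powRrM mulVf// powRr1.
clearbody U V; have UV : 0 < U + V by exact: addr_gt0.
have UVE : U + V = ((U + V) `^ s) `^ s^-1 by rewrite -powRrM mulfV// powRr1 ?ltW.
rewrite [leRHS]UVE; apply: ler_powRl; rewrite ?invr_ge0 ?(ltW s0)//.
have U0 : U `^ s != 0 by rewrite gt_eqF// powR_gt0.
have V0 : V `^ s != 0 by rewrite gt_eqF// powR_gt0.
have div x y : 0 <= x -> 0 < y -> (x / y) `^ s = x `^ s / y `^ s.
  move=> x0 y0; rewrite powRM ?invr_ge0 ?(ltW y0)//.
  by rewrite -(powR_inv1 (ltW y0)) powRAC powR_inv1 ?powR_ge0.
pose l := U / (U + V).
have l01 : 0 <= l <= 1.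
  by rewrite /l divr_ge0 ?(ltW Up) ?(ltW UV)//= ler_pdivrMr// mul1r; lra.
apply: (@le_trans _ _ ((U + V) `^ s * (l * ((\sum_i w i * u i `^ s) / U `^ s)
   + (1 - l) * ((\sum_i w i * v i `^ s) / V `^ s)))); last first.
  by rewrite Us Vs !divff// !mulr1 [l + _]addrC subrK mulr1.
rewrite !mulr_suml !mulr_sumr -big_split/= mulr_sumr; apply: ler_sum => i _.
rewrite (_ : u i + v i = (U + V) * (l * (u i / U) + (1 - l) * (v i / V))); last first.
  by rewrite /l; field; rewrite !gt_eqF.
have uU : 0 <= u i / U by rewrite divr_ge0// ltW.
have vV : 0 <= v i / V by rewrite divr_ge0// ltW.
rewrite powRM ?(ltW UV)//; last by have /andP[? ?] := l01; apply: addr_ge0; apply: mulr_ge0; lra.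
rewrite mulrCA ler_wpM2l ?powR_ge0//.
have := ler_wpM2l (w0 i) (@powR_convex _ _ _ _ s1 l01 uU vV).
move=> /le_trans; apply; rewrite le_eqVlt; apply/predU1P; left.
by rewrite !div//; field; rewrite U0 V0.
Qed.

End TwoPoint.

(** * Splitting off and updating coordinates, for sign vectors as well as for complex vectors *)

Section Cube.
Variable T : Type.

Definition ffun_cons {n} (c : T) (z : {ffun 'I_n -> T}) : {ffun 'I_n.+1 -> T} :=
  [ffun i => oapp z c (unlift ord0 i)].

Definition ffun_upd {n} (z : {ffun 'I_n -> T}) (i : 'I_n) (c : T) : {ffun 'I_n -> T} :=
  [ffun j => if j == i then c else z j].

Lemma ffun_cons0 n c (z : {ffun 'I_n -> T}) : ffun_cons c z ord0 = c.
Proof. by rewrite ffunE unlift_none. Qed.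

Lemma ffun_cons_lift n c (z : {ffun 'I_n -> T}) i :
  ffun_cons c z (lift ord0 i) = z i.
Proof. by rewrite ffunE liftK. Qed.

Lemma ffun_upd_cons0 n b c (z : {ffun 'I_n -> T}) :
  ffun_upd (ffun_cons b z) ord0 c = ffun_cons c z.
Proof.
apply/ffunP => i; rewrite [LHS]ffunE; case: (unliftP ord0 i) => [j ->|->].
  by rewrite eq_sym (negPf (neq_lift _ _)) !ffun_cons_lift.
by rewrite eqxx ffun_cons0.
Qed.

Lemma ffun_upd_cons_lift n b c (z : {ffun 'I_n -> T}) i :
  ffun_upd (ffun_cons b z) (lift ord0 i) c = ffun_cons b (ffun_upd z i c).
Proof.
apply/ffunP => j; rewrite [LHS]ffunE; case: (unliftP ord0 j) => [k ->|->].
  by rewrite (inj_eq lift_inj) !ffun_cons_lift ffunE.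
by rewrite (negPf (neq_lift _ _)) !ffun_cons0.
Qed.
End Cube.

Arguments ffun_cons {T n}.
Arguments ffun_upd {T n}.

(** * Multiaffine functions *)

Section Multiaffine.
Variable C : comNzRingType.

(** The domain is all of C^n rather than the cube, so that the noise operator becomes evaluation at
    the rescaled point c x. *)
Definition multiaffine {n} (F : {ffun 'I_n -> C} -> C) : Prop := forall z i c,
  F (ffun_upd z i c) =
    F (ffun_upd z i 0) + c * (F (ffun_upd z i 1) - F (ffun_upd z i 0)).

Lemma multiaffine_cons n (F : {ffun 'I_n.+1 -> C} -> C) c z : multiaffine F ->
  F (ffun_cons c z) =
    F (ffun_cons 0 z) + c * (F (ffun_cons 1 z) - F (ffun_cons 0 z)).
Proof. by move=> /(_ (ffun_cons 0 z) ord0 c); rewrite !ffun_upd_cons0. Qed.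

Lemma multiaffine_slice n (F : {ffun 'I_n.+1 -> C} -> C) b : multiaffine F ->
  multiaffine (fun z => F (ffun_cons b z)).
Proof. by move=> FM z i c; rewrite -!ffun_upd_cons_lift; exact: FM. Qed.

Lemma multiaffine_sum n (I : finType) (P : pred I) (a : I -> C)
    (F : I -> {ffun 'I_n -> C} -> C) : (forall t, P t -> multiaffine (F t)) ->
  multiaffine (fun z => \sum_(t | P t) a t * F t z).
Proof.
move=> FM z i c; rewrite -sumrB mulr_sumr -big_split/=.
by apply: eq_bigr => t Pt; rewrite (FM t Pt z i c); ring.
Qed.

(** By injectivity of f each variable occurs at most once in the product. *)
Lemma multiaffine_monomial n d (f : 'I_d -> 'I_n) : injective f ->
  multiaffine (fun z => \prod_(k < d) z (f k)).
Proof.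
move=> fI z i c; have [/existsP[k /eqP fk]|/existsPn nf] := boolP [exists k, f k == i].
  have E b : \prod_(j < d) ffun_upd z i b (f j) = b * \prod_(j < d | j != k) z (f j).
    rewrite (bigD1 k)//= ffunE fk eqxx; congr (_ * _); apply: eq_bigr => j jk.
    by rewrite ffunE -fk (inj_eq fI) (negPf jk).
  by rewrite !E; ring.
have E b : \prod_(j < d) ffun_upd z i b (f j) = \prod_(j < d) z (f j).
  by apply: eq_bigr => j _; rewrite ffunE (negPf (nf j)).
by rewrite !E subrr mulr0 addr0.
Qed.

(* For F multiaffine, F (cube_point c x) is the value at x of the noise operator
   with parameter c applied to x |-> F (cube_point 1 x). *)
Definition cube_point {n} (c : C) (x : cube n) : {ffun 'I_n -> C} :=
  [ffun i => c * (-1) ^+ x i].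

Lemma cube_point_cons n c b (x : cube n) :
  cube_point c (ffun_cons b x : cube n.+1) =
    ffun_cons (c * (-1) ^+ b) (cube_point c x).
Proof.
apply/ffunP => i; rewrite [LHS]ffunE; case: (unliftP ord0 i) => [j ->|->].
  by rewrite !ffun_cons_lift ffunE.
by rewrite !ffun_cons0.
Qed.
End Multiaffine.

Arguments multiaffine {C n}.
Arguments cube_point {C n}.

(** * Expectations, norms and tensorization over the coordinates *)

Section Hypercontractivity.
Variable R : realType.
Implicit Types (p q r s : R).

Lemma card_cube n : #|cube n| = (2 ^ n)%N.
Proof. by rewrite card_ffun card_bool card_ord. Qed.

Lemma expectation_cons n (g : cube n.+1 -> R) : expectation g =
  (expectation (fun x : cube n => g (ffun_cons false x)) +
   expectation (fun x : cube n => g (ffun_cons true x))) / 2.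
Proof.
rewrite /expectation; suff -> : \sum_x g x =
    \sum_x g (ffun_cons false x) + \sum_x g (ffun_cons true x).
  rewrite !card_cube expnS natrM; field.
  by rewrite pnatr_eq0 expn_eq0.
pose h (u : bool * cube n) : cube n.+1 := ffun_cons u.1 u.2.
rewrite (reindex h)/=; last first.
  exists (fun x => (x ord0, [ffun j => x (lift ord0 j)])) => [[b x]|x] _.
    rewrite /h/= ffun_cons0; congr pair; apply/ffunP => j.
    by rewrite ffunE ffun_cons_lift.
  apply/ffunP => i; rewrite /h/=; case: (unliftP ord0 i) => [j ->|->].
    by rewrite ffun_cons_lift ffunE.
  by rewrite ffun_cons0.
rewrite -(pair_big xpredT xpredT (fun b x => g (ffun_cons b x)))/=.
by rewrite big_bool addrC.
Qed.

Lemma expectation_ge0 n (g : cube n -> R) : (forall x, 0 <= g x) -> 0 <= expectation g.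
Proof. by move=> g0; rewrite divr_ge0// sumr_ge0. Qed.

Lemma ler_expectation n (f g : cube n -> R) : (forall x, f x <= g x) ->
  expectation f <= expectation g.
Proof. by move=> fg; rewrite ler_wpM2r ?invr_ge0// ler_sum. Qed.

Lemma expectationD n (f g : cube n -> R) :
  expectation (fun x => f x + g x) = expectation f + expectation g.
Proof. by rewrite /expectation big_split/= mulrDl. Qed.

Lemma expectationZ n (k : R) (f : cube n -> R) :
  expectation (fun x => k * f x) = k * expectation f.
Proof. by rewrite /expectation -mulr_sumr mulrA. Qed.

Lemma expectation0 (g : cube 0 -> R) x : expectation g = g x.
Proof.
rewrite /expectation card_cube divr1 (bigD1 x)//= big1 ?addr0// => y /eqP[].
by apply/ffunP => -[].
Qed.

(** Serves to move the average over one coordinate outside the L^s norm in the others, in the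
    induction on the dimension. *)
Lemma expectation_minkowski n (u v : cube n -> R) s : 1 <= s ->
  (forall x, 0 <= u x) -> (forall x, 0 <= v x) ->
  expectation (fun x => ((u x + v x) / 2) `^ s) `^ s^-1 <=
  (expectation (fun x => u x `^ s) `^ s^-1
   + expectation (fun x => v x `^ s) `^ s^-1) / 2.
Proof.
move=> s1 u0 v0; pose w := fun _ : cube n => #|cube n|%:R^-1 : R.
have s0 : s != 0 by rewrite gt_eqF//; lra.
have h : forall x : R, 0 <= x -> 0 <= x / 2 by move=> x; lra.
have := @weighted_minkowski R _ w (fun x => u x / 2) (fun x => v x / 2) s s1
  (fun _ => ltac:(by rewrite /w invr_ge0)) (fun x => h _ (u0 x)) (fun x => h _ (v0 x)).
have E (f : cube n -> R) : \sum_x w x * f x = expectation f.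
  by rewrite -mulr_sumr mulrC.
have half (f : cube n -> R) : (forall x, 0 <= f x) ->
    expectation (fun x => (f x / 2) `^ s) `^ s^-1 =
    expectation (fun x => f x `^ s) `^ s^-1 / 2.
  move=> f0; transitivity ((2^-1 `^ s * expectation (fun x => f x `^ s)) `^ s^-1).
    rewrite -expectationZ; congr (expectation _ `^ _); apply/funext => x.
    by rewrite mulrC powRM.
  rewrite powRM ?powR_ge0//; last by apply: expectation_ge0 => x; exact: powR_ge0.
  by rewrite -powRrM mulfV// powRr1// mulrC.
rewrite !E (half u)// (half v)// -mulrDl.
by rewrite (_ : (fun x => (u x / 2 + _) `^ s) = (fun x => ((u x + v x) / 2) `^ s))//;
  apply/funext => x; rewrite mulrDl.
Qed.

Lemma normc_ge0 (z : R[i]) : 0 <= normc z.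
Proof. by case: z => a b; rewrite sqrtr_ge0. Qed.

Lemma pnorm0 q (f : cube 0 -> R[i]) : q != 0 -> pnorm q f = normc (f [ffun=> false]).
Proof.
by move=> q0; rewrite /pnorm (expectation0 _ [ffun=> false]) -powRrM mulfV// powRr1// normc_ge0.
Qed.

Lemma pnormK n p (f : cube n -> R[i]) : p != 0 ->
  pnorm p f `^ p = expectation (fun x => normc (f x) `^ p).
Proof.
move=> p0; rewrite /pnorm -powRrM mulVf// powRr1//.
by apply: expectation_ge0 => x; exact: powR_ge0.
Qed.

Lemma ler_powR_root p q (x y : R) : 0 < q -> 0 <= x ->
  x `^ q^-1 <= y `^ p^-1 -> x <= y `^ (q / p).
Proof.
move=> q0 x0 xy; have := @ler_powRl R q _ _ (ltW q0) (powR_ge0 _ _) xy.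
by rewrite -!powRrM mulVf ?gt_eqF// powRr1// (mulrC _ q).
Qed.

(** Induction on n: the two-point inequality in the first coordinate, Minkowski in L^(q/p) to
    exchange it with the others, then the induction hypothesis on each slice. *)
Lemma pnorm_hypercontractive p q r n (F : {ffun 'I_n -> R[i]} -> R[i]) :
  1 < p <= 2 -> 2 <= q -> r ^+ 2 <= p - 1 -> r ^+ 2 * (q - 1) <= 1 ->
  multiaffine F ->
  pnorm q (fun x => F (cube_point (0 +i* r)%C x)) <=
  pnorm p (fun x => F (cube_point 1 x)).
Proof.
move=> p12 q2 rp rq; have /andP[p1 p2] := p12.
have p0 : p != 0 by rewrite gt_eqF//; lra.
have q0 : q != 0 by rewrite gt_eqF//; lra.
elim: n F => [|n IH] F FM.
  rewrite !pnorm0//.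
  rewrite (_ : cube_point _ _ = cube_point 1 [ffun=> false])//.
  by apply/ffunP => -[].
pose c : R[i] := (0 +i* r)%C.
pose A (z : {ffun 'I_n -> R[i]}) : R[i] := F (ffun_cons 0 z).
pose B (z : {ffun 'I_n -> R[i]}) : R[i] := F (ffun_cons 1 z) - F (ffun_cons 0 z).
have FE b z : F (ffun_cons b z) = A z + b * B z by exact: multiaffine_cons.
have F1 z : A z + B z = F (ffun_cons 1 z) by rewrite FE mul1r.
have F2 z : A z - B z = F (ffun_cons (-1) z) by rewrite FE mulN1r.
pose s := q / p.
have s1 : 1 <= s by rewrite ler_pdivlMr; lra.
have s0 : s != 0 by rewrite gt_eqF//; lra.
(* Noise acts on all coordinates but the first, which is fixed at b. *)
pose u (b : R[i]) (x : cube n) := normc (F (ffun_cons b (cube_point c x))) `^ p.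
have u0 b x : 0 <= u b x by exact: powR_ge0.
(* Since 1/s = p/q, the left-hand side is the p-th power of an L^q norm, and the induction
   hypothesis applies to the slice. *)
have slice b : expectation (fun x => u b x `^ s) `^ s^-1 <=
    expectation (fun x : cube n => normc (F (ffun_cons b (cube_point 1 x))) `^ p).
  have -> : (fun x => u b x `^ s)
      = (fun x => normc (F (ffun_cons b (cube_point c x))) `^ q).
    by apply/funext => x; rewrite -powRrM /s mulrC divfK.
  pose f (e : R[i]) (x : cube n) := F (ffun_cons b (cube_point e x)).
  rewrite (_ : _ `^ s^-1 = pnorm q (f c) `^ p); last first.
    by rewrite /pnorm -powRrM /s invf_div mulrC.
  rewrite -(pnormK n p (f 1) p0); apply: ler_powRl; [lra|exact: powR_ge0|].
  exact: (IH (fun z => F (ffun_cons b z)) (multiaffine_slice _ _ _ b FM)).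
(* With the other coordinates frozen at those of c x, F takes the values A + c B, A - c B under
   noise in the first coordinate and A + B, A - B without it. *)
have step : expectation (fun x : cube n.+1 => normc (F (cube_point c x)) `^ q)
    <= expectation (fun x => ((u 1 x + u (-1) x) / 2) `^ s).
  rewrite expectation_cons -expectationD mulrC -expectationZ.
  apply: ler_expectation => x; rewrite !cube_point_cons expr0 expr1 mulrN !mulr1.
  set z := cube_point c x; rewrite mulrC.
  have := @two_point_complex R p q r (A z) (B z) p12 q2 rp rq.
  rewrite -/c F1 F2 -mulNr -!FE => /ler_powR_root; rewrite -/s; apply; first lra.
  by rewrite divr_ge0 ?addr_ge0 ?powR_ge0.
have E0 : 0 <= expectation (fun x : cube n.+1 => normc (F (cube_point c x)) `^ q).
  by apply: expectation_ge0 => x; exact: powR_ge0.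
have pV0 : 0 <= p^-1 by rewrite invr_ge0; lra.
have qV (x : R) : x `^ q^-1 = (x `^ s^-1) `^ p^-1.
  by rewrite -powRrM; congr (_ `^ _); rewrite /s; field; rewrite p0.
clearbody u s; rewrite /pnorm [leLHS]qV.
apply: (@ler_powRl _ p^-1 _ _ pV0 (powR_ge0 _ _)).
have sV0 : 0 <= s^-1 by rewrite invr_ge0; lra.
apply: le_trans (@ler_powRl _ s^-1 _ _ sV0 E0 step) _.
apply: le_trans (@expectation_minkowski _ _ _ _ s1 (u0 1) (u0 (-1))) _.
rewrite [leRHS]expectation_cons ler_pM2r ?invr_gt0//.
have E (b : bool) (e : R[i]) : (-1) ^+ b = e ->
    expectation (fun x => normc (F (ffun_cons e (cube_point 1 x))) `^ p) =
    expectation (fun x : cube n =>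
      normc (F (cube_point 1 (ffun_cons b x : cube n.+1))) `^ p).
  by move=> <-; congr (expectation _); apply/funext => x; rewrite cube_point_cons mul1r.
apply: le_trans (lerD (slice 1) (slice (-1))) _.
by rewrite (E false 1 (expr0 _)) (E true (-1) (expr1 _)).
Qed.

(** * Homogeneous polynomials and the choice of r *)

Lemma pnormZ n q (c : R[i]) (f : cube n -> R[i]) : 0 < q ->
  pnorm q (fun x => c * f x) = normc c * pnorm q f.
Proof.
move=> q0; rewrite /pnorm.
transitivity ((normc c `^ q * expectation (fun x => normc (f x) `^ q)) `^ q^-1).
  rewrite -expectationZ; congr (expectation _ `^ _); apply/funext => x.
  by rewrite normcM powRM ?normc_ge0.
rewrite powRM ?powR_ge0//; last by apply: expectation_ge0 => x; exact: powR_ge0.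
by rewrite -powRrM mulfV ?gt_eqF// powRr1 ?normc_ge0.
Qed.

Lemma pnorm_homogeneous p q r n d (h : cube n -> R[i]) :
  1 < p <= 2 -> 2 <= q -> 0 <= r -> r ^+ 2 <= p - 1 -> r ^+ 2 * (q - 1) <= 1 ->
  is_homogeneous d h -> r ^+ d * pnorm q h <= pnorm p h.
Proof.
move=> p12 q2 r0 rp rq [a ha].
pose F (z : {ffun 'I_n -> R[i]}) :=
  \sum_(t : d.-tuple 'I_n | sorted (fun i j : 'I_n => (i < j)%N) t)
    a t * \prod_(k < d) z (tnth t k).
(* Strictly increasing index tuples have distinct entries. *)
have FM : multiaffine F.
  apply: multiaffine_sum => t st; apply: multiaffine_monomial; apply/tuple_uniqP.
  apply: (sorted_uniq _ _ st); first by move=> i j k; exact: ltn_trans.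
  by move=> i; exact: ltnn.
(* Homogeneity turns the noise operator into multiplication by c^d, of modulus r^d for c = i r. *)
have FE c : (fun x => F (cube_point c x)) = (fun x => c ^+ d * h x).
  apply/funext => x; rewrite ha /F /homogeneous_poly mulr_sumr; apply: eq_bigr => t _.
  rewrite mulrCA; congr (_ * _).
  under eq_bigr do rewrite ffunE.
  by rewrite big_split/= prodr_const card_ord.
have nc : normc (0 +i* r)%C = r by rewrite /= expr0n/= add0r sqrtr_sqr ger0_norm.
have ncd : normc ((0 +i* r)%C ^+ d) = r ^+ d.
  by elim: d {a ha F FM FE} => [|d IH]; rewrite ?normc1// !exprS normcM IH nc.
have := @pnorm_hypercontractive p q r n F p12 q2 rp rq FM.
rewrite !FE !pnormZ; [|lra..].
by rewrite ncd expr1n normc1 mul1r.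
Qed.
End Hypercontractivity.

Theorem theorem1 (R : realType) (p q : R) (n d : nat) (h : cube n -> R[i]) :
  1 < p -> p <= 2 -> 2 <= q ->
  (1 <= d)%N -> (d <= n)%N ->
  is_homogeneous d h ->
  pnorm q h <=
    Num.max (powR (q - 1) (d%:R / 2)) (1 / powR (p - 1) (d%:R / 2)) * pnorm p h.
Proof.
move=> p1 p2 q2 _ _ hh.
have p12 : 1 < p <= 2 by rewrite p1.
have pw (x : R) : 0 < x -> (x `^ 2^-1) ^+ d = x `^ (d%:R / 2).
  by move=> x0; rewrite -powR_mulrn ?powR_ge0// -powRrM mulrC.
have sq (x : R) : 0 < x -> (x `^ 2^-1) ^+ 2 = x.
  by move=> x0; rewrite -powR_mulrn ?powR_ge0// -powRrM mulVf// powRr1 ?ltW.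
have N0 : 0 <= pnorm p h by exact: powR_ge0.
(* The test decides which of p - 1 and 1/(q - 1) is smaller; r^2 is that one, and r^(-d) is the
   matching entry of the maximum. *)
have [pq|qp] := leP ((p - 1) * (q - 1)) 1.
  apply: (@le_trans _ _ (1 / (p - 1) `^ (d%:R / 2) * pnorm p h)); last first.
    by rewrite ler_wpM2r// le_max lexx orbT.
  rewrite mulrAC mul1r ler_pdivlMr; last by apply: powR_gt0; lra.
  rewrite mulrC -pw; last by lra.
  by apply: pnorm_homogeneous => //; rewrite ?powR_ge0// sq//; lra.
apply: (@le_trans _ _ ((q - 1) `^ (d%:R / 2) * pnorm p h)); last first.
  by rewrite ler_wpM2r// le_max lexx.
rewrite -ler_pdivrMl; last by apply: powR_gt0; lra.
rewrite -pw; last by lra.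
rewrite -exprVn; apply: pnorm_homogeneous => //.
- by rewrite invr_ge0 powR_ge0.
- by rewrite exprVn sq; [rewrite -div1r ler_pdivrMr|]; lra.
- by rewrite exprVn sq; [rewrite mulVf// gt_eqF|]; lra.
Qed.
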